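(* Let $p$ be a prime and let $(\sigma,\delta)$ be an arbitrary $\mathbb{F}_p$-linear, local skew derivation on $\mathbb{F}_p[[x]]$. Then $R=\mathbb{F}_p[[x]][[y;\sigma,\delta]]$ is polynormal.
   Context: A skew derivation on a ring $B$ is a pair $(\sigma,\delta)$ with $\sigma$ an automorphism of $B$ and $\delta:B\to B$ additive with $\delta(rs)=\delta(r)s+\sigma(r)\delta(s)$. If $(B,\mathfrak m)$ is a complete local ring, $(\sigma,\delta)$ is local if $\sigma(\mathfrak m^i)=\mathfrak m^i$ and $\delta(\mathfrak m^i)\subseteq\mathfrak m^{i+1}$ for all $i\ge0$; then the skew power series ring $B[[y;\sigma,\delta]]$ exists: it is the left $B$-module of formal power series $\sum_j b_jy^j$ with the continuous multiplication extending $yr=\sigma(r)y+\delta(r)$ $(r\in B)$. $(\sigma,\delta)$ is $\mathbb{F}_p$-linear if $\sigma(a)=a$ and $\delta(a)=0$ for all $a\in\mathbb{F}_p$. A ring $R$ is polynormal if, whenever $J\subsetneq I$ are two-sided ideals of $R$, the ideal $I/J$ of $R/J$ contains a nonzero normal element, where an element $a$ of a ring $S$ is normal if $aS=Sa$. *)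

(* Defs.v *)
From HB Require Import structures.
From mathcomp Require Import all_boot all_order all_algebra.
From mathcomp Require Import boolp classical_sets.

Set Implicit Arguments.
Unset Strict Implicit.
Unset Printing Implicit Defensive.

Import GRing.Theory.

Local Open Scope classical_set_scope.
Local Open Scope ring_scope.
Local Open Scope quotient_scope.

Record twoSidedIdeal (R : pzRingType) := TwoSidedIdeal {
  ideal_set :> set R;
  ideal0 : ideal_set 0;
  idealB : forall u v, ideal_set u -> ideal_set v -> ideal_set (u - v);
  idealMl : forall a u, ideal_set u -> ideal_set (a * u);
  idealMr : forall a u, ideal_set u -> ideal_set (u * a) }.

Definition ideal_pred (R : pzRingType) (J : twoSidedIdeal R) : R -> bool :=
  fun x => `[< ideal_set J x >].

Lemma ideal_pred_zmod_closed (R : pzRingType) (J : twoSidedIdeal R) :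
  zmod_closed (ideal_pred J).
Proof.
split; first by apply/asboolP; apply: ideal0.
by move=> u v /asboolP Ju /asboolP Jv; apply/asboolP; apply: idealB.
Qed.

HB.instance Definition _ (R : pzRingType) (J : twoSidedIdeal R) :=
  GRing.isZmodClosed.Build R (ideal_pred J) (ideal_pred_zmod_closed J).

Definition ideal_zmodClosed (R : pzRingType) (J : twoSidedIdeal R) :
  zmodClosed R := GRing.ZmodClosed.clone R (ideal_pred J) _.

(* The library only puts a ring structure on quotients of commutative rings;
   the additive quotient [Quotient.quot] is reused here. *)
Definition quotientRing (R : pzRingType) (J : twoSidedIdeal R) : Type :=
  Quotient.quot (ideal_zmodClosed J).

HB.instance Definition _ (R : pzRingType) (J : twoSidedIdeal R) :=
  GRing.Zmodule.on (quotientRing J).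

Section QuotientRing.
Variables (R : pzRingType) (J : twoSidedIdeal R).

Definition quot_proj (x : R) : quotientRing J :=
  \pi_(Quotient.quot (ideal_zmodClosed J)) x.

Lemma quot_projP x y : quot_proj x = quot_proj y <-> ideal_set J (x - y).
Proof.
split=> [/eqP|Jxy].
  by rewrite /quot_proj -Quotient.idealrBE => /asboolP.
by apply/eqP; rewrite /quot_proj -Quotient.idealrBE; apply/asboolP.
Qed.

Lemma quot_projK (x : quotientRing J) : quot_proj (repr x) = x.
Proof. exact: reprK. Qed.

Lemma quot_proj_repr x : ideal_set J (repr (quot_proj x) - x).
Proof. by apply/quot_projP; rewrite quot_projK. Qed.

Definition quot_one : quotientRing J := quot_proj 1.
Definition quot_mul (x y : quotientRing J) : quotientRing J :=
  quot_proj (repr x * repr y).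

Lemma quot_projM x y : quot_proj (x * y) = quot_mul (quot_proj x) (quot_proj y).
Proof.
apply/esym/quot_projP; set x' := repr _; set y' := repr _.
have -> : x' * y' - x * y = (x' - x) * y' - (- x) * (y' - y).
  by rewrite mulrBl mulNr mulrBr opprK addrA subrK.
apply: idealB; first by apply: idealMr; apply: quot_proj_repr.
by apply: idealMl; apply: quot_proj_repr.
Qed.

Lemma quot_projD x y : quot_proj (x + y) = quot_proj x + quot_proj y.
Proof. by rewrite /quot_proj piE. Qed.

Lemma quot_mulA : associative quot_mul.
Proof.
move=> x y z; rewrite -(quot_projK x) -(quot_projK y) -(quot_projK z).
by rewrite -!quot_projM mulrA.
Qed.

Lemma quot_mul1r : left_id quot_one quot_mul.
Proof. by move=> x; rewrite -(quot_projK x) -quot_projM mul1r. Qed.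

Lemma quot_mulr1 : right_id quot_one quot_mul.
Proof. by move=> x; rewrite -(quot_projK x) -quot_projM mulr1. Qed.

Lemma quot_mulDl : left_distributive quot_mul +%R.
Proof.
move=> x y z; rewrite -(quot_projK x) -(quot_projK y) -(quot_projK z).
by rewrite -quot_projD -!quot_projM -quot_projD mulrDl.
Qed.

Lemma quot_mulDr : right_distributive quot_mul +%R.
Proof.
move=> x y z; rewrite -(quot_projK x) -(quot_projK y) -(quot_projK z).
by rewrite -quot_projD -!quot_projM -quot_projD mulrDr.
Qed.

HB.instance Definition _ := GRing.Zmodule_isPzRing.Build (quotientRing J)
  quot_mulA quot_mul1r quot_mulr1 quot_mulDl quot_mulDr.

Lemma quot_proj_zmod_morphism : zmod_morphism quot_proj.
Proof. by move=> x y; rewrite /quot_proj !piE. Qed.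

Lemma quot_proj_monoid_morphism : monoid_morphism quot_proj.
Proof. by split=> // x y; apply: quot_projM. Qed.

HB.instance Definition _ :=
  GRing.isZmodMorphism.Build R (quotientRing J) quot_proj
    quot_proj_zmod_morphism.
HB.instance Definition _ :=
  GRing.isMonoidMorphism.Build R (quotientRing J) quot_proj
    quot_proj_monoid_morphism.

End QuotientRing.

Definition normal_element (S : pzRingType) (a : S) : Prop :=
  [set a * s | s in [set: S]] = [set s * a | s in [set: S]].

Definition polynormal (R : pzRingType) : Prop :=
  forall I J : twoSidedIdeal R, J `<` I ->
    exists a : quotientRing J,
      [/\ (quot_proj J @` I) a, a != 0 & normal_element a].

Definition ideal_mul (B : pzRingType) (I J : set B) : set B :=
  [set s | exists n (u v : 'I_n -> B),
     (forall k, I (u k) /\ J (v k)) /\ s = \sum_(k < n) u k * v k].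

Fixpoint ideal_exp (B : pzRingType) (m : set B) (i : nat) : set B :=
  if i is i'.+1 then ideal_mul m (ideal_exp m i') else [set: B].

Record skewDerivation (B : pzRingType) := SkewDerivation {
  sd_sigma : {rmorphism B -> B};
  sd_delta : {additive B -> B};
  sd_sigma_bij : bijective sd_sigma;
  sd_deltaM : forall r s : B,
    sd_delta (r * s) = sd_delta r * s + sd_sigma r * sd_delta s }.

Definition local_skew (B : pzRingType) (m : set B) (D : skewDerivation B) :=
  forall i, sd_sigma D @` ideal_exp m i = ideal_exp m i /\
            sd_delta D @` ideal_exp m i `<=` ideal_exp m i.+1.

(* A record rather than a bare function type, on which the library may put
   pointwise operations. *)
Record fps (F : Type) := Fps { coefs : nat -> F }.

Lemma fps_ext (F : Type) (f g : fps F) :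
  (forall i, coefs f i = coefs g i) -> f = g.
Proof. by case: f g => [f] [g] /= fg; congr Fps; apply: funext. Qed.

HB.instance Definition _ (F : Type) := gen_eqMixin (fps F).
HB.instance Definition _ (F : Type) := gen_choiceMixin (fps F).

Section FpsZmod.
Variable F : zmodType.

Definition fps_zero : fps F := Fps (fun=> 0).
Definition fps_opp (f : fps F) := Fps (fun i => - coefs f i).
Definition fps_add (f g : fps F) := Fps (fun i => coefs f i + coefs g i).

Fact fps_addA : associative fps_add.
Proof. by move=> f g h; apply: fps_ext => i /=; rewrite addrA. Qed.
Fact fps_addC : commutative fps_add.
Proof. by move=> f g; apply: fps_ext => i /=; rewrite addrC. Qed.
Fact fps_add0r : left_id fps_zero fps_add.
Proof. by move=> f; apply: fps_ext => i /=; rewrite add0r. Qed.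
Fact fps_addNr : left_inverse fps_zero fps_opp fps_add.
Proof. by move=> f; apply: fps_ext => i /=; rewrite addNr. Qed.

HB.instance Definition _ :=
  GRing.isZmodule.Build (fps F) fps_addA fps_addC fps_add0r fps_addNr.

Lemma coefs0 i : coefs (0 : fps F) i = 0. Proof. by []. Qed.
Lemma coefsN (f : fps F) i : coefs (- f) i = - coefs f i. Proof. by []. Qed.
Lemma coefsD (f g : fps F) i : coefs (f + g) i = coefs f i + coefs g i.
Proof. by []. Qed.
Lemma coefsB (f g : fps F) i : coefs (f - g) i = coefs f i - coefs g i.
Proof. by []. Qed.
Lemma coefs_sum (I : Type) (r : seq I) (P : pred I) (f : I -> fps F) i :
  coefs (\sum_(k <- r | P k) f k) i = \sum_(k <- r | P k) coefs (f k) i.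
Proof. by elim/big_rec2: _ => // k a b _ <-; rewrite coefsD. Qed.

End FpsZmod.

Section FpsRing.
Variable F : comNzRingType.
Implicit Types f g h : fps F.

Definition fps_one : fps F := Fps (fun i => (i == 0%N)%:R).
Definition fps_mul f g : fps F :=
  Fps (fun n => \sum_(i < n.+1) coefs f i * coefs g (n - i)%N).

Definition fps_trunc N f : {poly F} := \poly_(i < N) coefs f i.

Lemma fps_mul_trunc N f g n : (n < N)%N ->
  coefs (fps_mul f g) n = (fps_trunc N f * fps_trunc N g)`_n.
Proof.
move=> ltnN; rewrite coefM /=; apply: eq_bigr => i _; rewrite !coef_poly.
have leiN : (i < N)%N by apply: leq_ltn_trans ltnN; rewrite -ltnS.
by rewrite leiN (leq_ltn_trans (leq_subr _ _) ltnN).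
Qed.

Fact fps_mulC : commutative fps_mul.
Proof.
by move=> f g; apply: fps_ext => n; rewrite !(@fps_mul_trunc n.+1) // mulrC.
Qed.

Fact fps_mulA : associative fps_mul.
Proof.
move=> f g h; apply: fps_ext => n; set N := n.+1.
transitivity (fps_trunc N f * fps_trunc N g * fps_trunc N h)`_n.
  rewrite -mulrA coefM; apply: eq_bigr => i _.
  by rewrite (@fps_mul_trunc N) ?ltnS ?leq_subr // coef_poly ltn_ord.
rewrite coefM; apply: eq_bigr => i _.
rewrite (@fps_mul_trunc N) // coef_poly.
by rewrite (leq_ltn_trans (leq_subr _ _)) // ltnSn.
Qed.

Fact fps_mul1r : left_id fps_one fps_mul.
Proof.
move=> f; apply: fps_ext => n /=; rewrite big_ord_recl /= mul1r subn0.
by rewrite big1 ?addr0 // => i _; rewrite mul0r.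
Qed.

Fact fps_mulDl : left_distributive fps_mul +%R.
Proof.
move=> f g h; apply: fps_ext => n; rewrite coefsD /= -big_split /=.
by apply: eq_bigr => i _; rewrite mulrDl.
Qed.

Fact fps_one_neq0 : fps_one != 0.
Proof.
by apply/eqP => /(congr1 (fun f => coefs f 0%N)) /eqP; rewrite /= oner_eq0.
Qed.

HB.instance Definition _ := GRing.Zmodule_isComNzRing.Build (fps F)
  fps_mulA fps_mulC fps_mul1r fps_mulDl fps_one_neq0.

Lemma coefs1 i : coefs (1 : fps F) i = (i == 0%N)%:R. Proof. by []. Qed.
Lemma coefsM f g n :
  coefs (f * g) n = \sum_(i < n.+1) coefs f i * coefs g (n - i)%N.
Proof. by []. Qed.

Definition fps_const (a : F) : fps F := Fps (fun i => if i is 0 then a else 0).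
Definition fps_x : fps F := Fps (fun i => (i == 1%N)%:R).

(* The maximal ideal (x), when F is a field. *)
Definition fps_max : set (fps F) := [set fps_x * g | g in [set: fps F]].

Lemma coefs_xM f n :
  coefs (fps_x * f) n = if n is n'.+1 then coefs f n' else 0.
Proof.
case: n => [|n]; rewrite coefsM big_ord_recl /= mul0r add0r.
  by rewrite big_ord0.
rewrite big_ord_recl /= mul1r subn1 big1 ?addr0 // => i _.
by rewrite /bump /= mul0r.
Qed.

Lemma fps_maxE f : fps_max f <-> coefs f 0%N = 0.
Proof.
split=> [[g _ <-]|f0]; first by rewrite coefs_xM.
exists (Fps (fun i => coefs f i.+1)) => //.
by apply: fps_ext => -[|i]; rewrite coefs_xM.
Qed.

Definition fps_vanish (i : nat) f := forall j, (j < i)%N -> coefs f j = 0.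

Lemma fps_vanishM i j f g :
  fps_vanish i f -> fps_vanish j g -> fps_vanish (i + j) (f * g).
Proof.
move=> fi gj n ltn; rewrite coefsM big1 // => k _.
have [ltki|leik] := ltnP k i; first by rewrite fi // mul0r.
have lekn : (k <= n)%N by rewrite -ltnS.
by rewrite gj ?mulr0 // ltn_subLR // (leq_trans ltn) // leq_add2r.
Qed.

Lemma fps_vanish_sum i (I : Type) (r : seq I) (P : pred I) (f : I -> fps F) :
  (forall k, P k -> fps_vanish i (f k)) ->
  fps_vanish i (\sum_(k <- r | P k) f k).
Proof. by move=> fi j ltji; rewrite coefs_sum big1 // => k /fi ->. Qed.

Lemma fps_ideal_expE i f : ideal_exp fps_max i f <-> fps_vanish i f.
Proof.
elim: i f => [|i IHi] f /=; first by split.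
split=> [[n [u [v [uv ->]]]]|fi].
  apply: fps_vanish_sum => k _; have [/fps_maxE u0 /IHi vi] := uv k.
  by rewrite -add1n; apply: fps_vanishM => // -[].
exists 1%N, (fun=> fps_x), (fun=> Fps (fun j => coefs f j.+1)); split.
  move=> _; split; first by apply/fps_maxE.
  by apply/IHi => j ltji /=; apply: fi.
rewrite big_ord1; apply: fps_ext => -[|j]; rewrite coefs_xM //.
exact: fi.
Qed.

End FpsRing.

(* [sd_comm D i k r] is the coefficient of [y^k] in [y^i r]: the sum of all
   words in k letters sigma and (i - k) letters delta, applied to r. *)
Fixpoint sd_comm (B : pzRingType) (D : skewDerivation B) (i k : nat) (r : B) :=
  if i is i'.+1 then
    (if k is k'.+1 then sd_sigma D (sd_comm D i' k' r) else 0)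
      + sd_delta D (sd_comm D i' k r)
  else if k is 0 then r else 0.

Section SkewComm.
Variables (B : pzRingType) (D : skewDerivation B).
Local Notation sw := (sd_comm D).

Lemma sd_comm_is_zmod_morphism i k : zmod_morphism (sw i k).
Proof.
elim: i k => [|i IHi] [|k] r s //=; rewrite ?subr0 //.
  by rewrite !add0r IHi raddfB.
by rewrite !IHi !raddfB /= opprD addrACA.
Qed.

HB.instance Definition _ i k := GRing.isZmodMorphism.Build B B (sw i k)
  (sd_comm_is_zmod_morphism i k).

Lemma sd_comm_gt i k r : (i < k)%N -> sw i k r = 0.
Proof.
elim: i k => [|i IHi] [|k] //= ltik.
by rewrite !IHi ?raddf0 ?addr0 // ltnW.
Qed.

Lemma sd_delta1 : sd_delta D 1 = 0.
Proof.
have := sd_deltaM D 1 1; rewrite mulr1 rmorph1 mul1r mulr1.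
by move/eqP; rewrite -subr_eq subrr => /eqP.
Qed.

Lemma sd_comm1 i k : sw i k 1 = (i == k)%:R.
Proof.
elim: i k => [|i IHi] [|k] //=; rewrite !IHi.
  by case: i {IHi} => [|i]; rewrite ?sd_delta1 ?raddf0 addr0.
by rewrite eqSS rmorph_nat; case: (i == k.+1); rewrite ?sd_delta1 ?raddf0 addr0.
Qed.

(* Coefficients of y^k on both sides of y^i (r s) = (y^i r) s. *)
Lemma sd_commM M i k r s : (i < M)%N ->
  sw i k (r * s) = \sum_(j < M) sw i j r * sw j k s.
Proof.
elim: i M k => [|i IHi] [|M] k //=; rewrite ?ltnS => leiM.
  rewrite big_ord_recl /= big1 ?addr0 => [|j _]; last by rewrite mul0r.
  by case: k => [|k]; rewrite ?mulr0.
pose T := \sum_(j < M) (sw i j r * sw j k s).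
have -> : sw i k (r * s) = \sum_(j < M.+1) sw i j r * sw j k s.
  by apply: IHi; apply: leqW.
rewrite raddf_sum /=.
under [X in _ + X]eq_bigr do rewrite sd_deltaM.
rewrite big_split /=.
under [RHS]eq_bigr do rewrite mulrDl.
rewrite big_split /= [X in _ = X + _]big_ord_recl /= mul0r add0r.
rewrite addrCA [RHS]addrC; congr (_ + _).
rewrite [X in _ + X]big_ord_recr /= (@sd_comm_gt i M r) // rmorph0 mul0r addr0.
under [RHS]eq_bigr do rewrite mulrDr.
rewrite big_split /=; congr (_ + _).
case: k {T} => [|k]; first by rewrite big1 // => j _; rewrite mulr0.
rewrite (IHi _ _ leiM) rmorph_sum /=.
by apply: eq_bigr => j _; rewrite rmorphM.
Qed.

(* Coefficients of y^k on both sides of y^(i + j) r = y^i (y^j r). *)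
Lemma sd_commD i j k r :
  sw (i + j) k r = \sum_(b < k.+1) sw i b (sw j (k - b) r).
Proof.
elim: i k => [|i IHi] k.
  by rewrite big_ord_recl /= subn0 big1 ?addr0.
rewrite addSn /= big_split /= IHi raddf_sum /=; congr (_ + _).
case: k => [|k]; first by rewrite big_ord1.
by rewrite big_ord_recl /= add0r IHi rmorph_sum.
Qed.

End SkewComm.

Record skewPowerSeries (F : comNzRingType) (D : skewDerivation (fps F))
    (locD : local_skew (@fps_max F) D) :=
  SkewPowerSeries { ycoefs : nat -> fps F }.

Section SkewPowerSeriesRing.
Variables (F : comNzRingType) (D : skewDerivation (fps F)).
Variable locD : local_skew (@fps_max F) D.
Local Notation R := (skewPowerSeries locD).
Local Notation Y u := (@SkewPowerSeries F D locD u).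
Local Notation sw := (sd_comm D).
Implicit Types f g h : R.

Lemma ys_ext f g : (forall n, ycoefs f n = ycoefs g n) -> f = g.
Proof. by case: f g => [f] [g] /= fg; congr SkewPowerSeries; apply: funext. Qed.

HB.instance Definition _ := gen_eqMixin R.
HB.instance Definition _ := gen_choiceMixin R.

Definition ys_zero : R := Y (fun=> 0).
Definition ys_opp f : R := Y (fun n => - ycoefs f n).
Definition ys_add f g : R := Y (fun n => ycoefs f n + ycoefs g n).

Fact ys_addA : associative ys_add.
Proof. by move=> f g h; apply: ys_ext => i /=; rewrite addrA. Qed.
Fact ys_addC : commutative ys_add.
Proof. by move=> f g; apply: ys_ext => i /=; rewrite addrC. Qed.
Fact ys_add0r : left_id ys_zero ys_add.
Proof. by move=> f; apply: ys_ext => i /=; rewrite add0r. Qed.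
Fact ys_addNr : left_inverse ys_zero ys_opp ys_add.
Proof. by move=> f; apply: ys_ext => i /=; rewrite addNr. Qed.

HB.instance Definition _ :=
  GRing.isZmodule.Build R ys_addA ys_addC ys_add0r ys_addNr.

Lemma ycoefsD f g n : ycoefs (f + g) n = ycoefs f n + ycoefs g n.
Proof. by []. Qed.

Definition ys_one : R := Y (fun n => (n == 0%N)%:R).

(* The coefficient of y^n in f g is the sum over k <= n and all i of
   f_i [y^k](y^i g_(n-k)).  As delta raises the x-adic order, the i-th term
   has order at least i - k, so only i <= n + l contribute to the coefficient
   of x^l: see [ys_mul_trunc]. *)
Definition ys_mul f g : R :=
  Y (fun n => Fps (fun l =>
    \sum_(k < n.+1) \sum_(i < (n + l).+1)
      coefs (ycoefs f i * sw i k (ycoefs g (n - k))) l)).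

Lemma fps_vanish_le i j (u : fps F) :
  (i <= j)%N -> fps_vanish j u -> fps_vanish i u.
Proof. by move=> leij uj k ltki; apply: uj; apply: leq_trans leij. Qed.

Lemma vanish_sigma i u : fps_vanish i u -> fps_vanish i (sd_sigma D u).
Proof.
move=> /fps_ideal_expE iu; apply/fps_ideal_expE.
by have [<- _] := locD i; exists u.
Qed.

Lemma vanish_delta i u : fps_vanish i u -> fps_vanish i.+1 (sd_delta D u).
Proof.
move=> /fps_ideal_expE iu; apply/fps_ideal_expE.
by have [_] := locD i; apply; exists u.
Qed.

Lemma vanishD i (u v : fps F) :
  fps_vanish i u -> fps_vanish i v -> fps_vanish i (u + v).
Proof. by move=> ui vi j ltji; rewrite coefsD ui ?vi ?addr0. Qed.

Lemma vanish_sw l i k u : fps_vanish l u -> fps_vanish (l + i - k) (sw i k u).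
Proof.
move=> ul; elim: i k => [|i IHi] [|k] //=; first by rewrite addn0 subn0.
  by rewrite add0r addnS subn0 -[X in X.+1]subn0; apply: vanish_delta.
rewrite addnS subSS; apply: vanishD; first exact: vanish_sigma.
apply: fps_vanish_le (vanish_delta (IHi k.+1)).
by rewrite subnS; case: (_ - k)%N.
Qed.

Lemma ys_mul_trunc N f g n l : (n + l < N)%N ->
  coefs (ycoefs (ys_mul f g) n) l =
  coefs (\sum_(k < n.+1) \sum_(i < N) ycoefs f i * sw i k (ycoefs g (n - k))) l.
Proof.
move=> ltN; rewrite coefs_sum /=; apply: eq_bigr => k _; rewrite coefs_sum.
rewrite (big_ord_widen N
  (fun i => coefs (ycoefs f i * sw i k (ycoefs g (n - k))) l)) //.
rewrite big_mkcond /=; apply: eq_bigr => i _; case: ifP => // /negbT.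
rewrite -leqNgt => lei.
have u0 (u : fps F) : fps_vanish 0 u by [].
have := fps_vanishM (u0 (ycoefs f i)) (@vanish_sw _ i k _ (u0 (ycoefs g (n - k)))).
move=> van; apply/esym/van; rewrite !add0n ltn_subRL; apply: leq_trans lei.
by rewrite ltnS leq_add2r -ltnS.
Qed.

Definition eqmodx L (u v : fps F) := fps_vanish L (u - v).

Lemma eqmodxP L u v :
  eqmodx L u v <-> forall l, (l < L)%N -> coefs u l = coefs v l.
Proof.
split=> uv l /uv; first by rewrite coefsB => /eqP; rewrite subr_eq0 => /eqP.
by rewrite coefsB => ->; rewrite subrr.
Qed.

Lemma eqmodx_sum L (I : Type) (r : seq I) (P : pred I) (u v : I -> fps F) :
  (forall i, P i -> eqmodx L (u i) (v i)) ->
  eqmodx L (\sum_(i <- r | P i) u i) (\sum_(i <- r | P i) v i).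
Proof. by rewrite /eqmodx -sumrB; apply: fps_vanish_sum. Qed.

Lemma eqmodx_mull L w u v : eqmodx L u v -> eqmodx L (w * u) (w * v).
Proof.
by rewrite /eqmodx -mulrBr => uv; rewrite -[L]add0n; apply: fps_vanishM.
Qed.

Lemma eqmodx_mulr L w u v : eqmodx L u v -> eqmodx L (u * w) (v * w).
Proof. by rewrite ![_ * w]mulrC; apply: eqmodx_mull. Qed.

Lemma eqmodx_sw L i k u v : eqmodx L u v -> eqmodx L (sw i k u) (sw i k v).
Proof.
move=> uv; have [ltik|leki] := ltnP i k.
  by rewrite !sd_comm_gt //; apply/eqmodxP.
rewrite /eqmodx -raddfB; apply: fps_vanish_le (@vanish_sw _ i k _ uv).
by rewrite -addnBA // leq_addr.
Qed.

Lemma ys_mul_mod N L f g n : (n + L <= N)%N ->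
  eqmodx L (ycoefs (ys_mul f g) n)
    (\sum_(k < n.+1) \sum_(i < N) ycoefs f i * sw i k (ycoefs g (n - k))).
Proof.
move=> leN; apply/eqmodxP => l ltl; apply: ys_mul_trunc.
by apply: leq_trans leN; rewrite -addnS leq_add2l.
Qed.

Lemma sum_triangle (V : nmodType) N P (T : nat -> nat -> V) : (N <= P)%N ->
  \sum_(e < N) \sum_(a < e.+1) T a (e - a)%N =
  \sum_(a < P) \sum_(i < N | (a + i < N)%N) T a i.
Proof.
move=> leNP.
transitivity (\sum_(e < N) \sum_(a < P | (a < e.+1)%N) T a (e - a)%N).
  apply: eq_bigr => e _.
  by rewrite (big_ord_widen P (fun a => T a (e - a)%N)) // (leq_trans _ leNP).
rewrite (exchange_big_dep xpredT) //=; apply: eq_bigr => a _.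
transitivity (\sum_(a <= e < N) T a (e - a)%N).
  by rewrite big_geq_mkord; apply: eq_bigl => e; rewrite ltnS.
rewrite -[X in \sum_(X <= _ < _) _]add0n big_addn big_mkord.
rewrite (big_ord_widen N (fun i => T a (i + a - a)%N)) ?leq_subr //.
by apply: eq_big => [i|i _]; rewrite ?ltn_subRL ?addnK.
Qed.

Fact ys_mulA : associative ys_mul.
Proof.
move=> f g h; apply: ys_ext => n; apply: fps_ext => l.
pose L := l.+1; pose N := (n + L)%N; pose M := (N + N)%N.
pose G j c i m := ycoefs f j * sw j c (ycoefs g i)
                    * sw (c + i)%N m (ycoefs h (n - m)).
pose S := \sum_(m < n.+1) \sum_(j < M) \sum_(c < M) \sum_(i < N) G j c i m.
have leNM : (N <= M)%N by apply: leq_addr.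
have eql : eqmodx L (ycoefs (ys_mul (ys_mul f g) h) n) S.
  apply/eqmodxP => k ltkL; rewrite (@ys_mul_trunc N) ?ltn_add2l //.
  move: k ltkL; apply/eqmodxP; apply: eqmodx_sum => m _.
  apply/eqmodxP => k ltkL; transitivity (coefs (\sum_(e < N)
    \sum_(a < e.+1) \sum_(j < M) G j a (e - a)%N m) k); last first.
    rewrite (@sum_triangle _ N M (fun a i => \sum_(j < M) G j a i m)) //.
    rewrite [in RHS]exchange_big /=.
    move: k ltkL; apply/eqmodxP; apply: eqmodx_sum => c _.
    rewrite [X in eqmodx _ _ X]exchange_big /= big_mkcond /=.
    apply: eqmodx_sum => i _; case: ifP => [_|/negbT]; first by apply/eqmodxP.
    rewrite -leqNgt => leN; rewrite /eqmodx sub0r -sumrN.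
    apply: fps_vanish_sum => j _; rewrite /G -mulrN -raddfN.
    rewrite -[L]add0n; apply: fps_vanishM => //.
    apply: fps_vanish_le (@vanish_sw 0 _ _ _ _) => //.
    rewrite add0n leq_subRL; last first.
      by apply: leq_trans leN; rewrite (leq_trans (leq_ord m)) ?leq_addr.
    by apply: leq_trans leN; rewrite leq_add2r leq_ord.
  move: k ltkL; apply/eqmodxP; apply: eqmodx_sum => e _.
  apply/eqmodxP => k ltkL; transitivity (coefs ((\sum_(a < e.+1) \sum_(j < M)
     ycoefs f j * sw j a (ycoefs g (e - a))) * sw e m (ycoefs h (n - m))) k).
    move: k ltkL; apply/eqmodxP; apply: eqmodx_mulr; apply: ys_mul_mod.
    by apply: leq_add; [apply: ltnW | apply: leq_addl].
  congr (coefs _ k); rewrite mulr_suml; apply: eq_bigr => a _.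
  by rewrite mulr_suml; apply: eq_bigr => j _; rewrite /G subnKC // -ltnS.
suff eqr : eqmodx L (ycoefs (ys_mul f (ys_mul g h)) n) S.
  by rewrite (iffLR (eqmodxP _ _ _) eql) // (iffLR (eqmodxP _ _ _) eqr).
apply/eqmodxP => k ltkL; rewrite (@ys_mul_trunc M); last first.
  by apply: leq_trans leNM; rewrite ltn_add2l.
transitivity (coefs (\sum_(b < n.+1) \sum_(j < M) ycoefs f j * sw j b
  (\sum_(q < (n - b).+1) \sum_(i < N)
     ycoefs g i * sw i q (ycoefs h (n - b - q)))) k).
  move: k ltkL; apply/eqmodxP; apply: eqmodx_sum => b _; apply: eqmodx_sum.
  move=> j _; apply: eqmodx_mull; apply: eqmodx_sw; apply: ys_mul_mod.
  by rewrite leq_add2r leq_subr.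
congr (coefs _ k); rewrite /S exchange_big [RHS]exchange_big /=.
apply: eq_bigr => j _.
transitivity (\sum_(i < N) \sum_(c < M) \sum_(b < n.+1) \sum_(q < (n - b).+1)
   ycoefs f j * (sw j c (ycoefs g i) * sw c b (sw i q (ycoefs h (n - b - q))))).
  under [RHS]eq_bigr do rewrite exchange_big.
  rewrite [RHS]exchange_big; apply: eq_bigr => b _.
  under [RHS]eq_bigr do rewrite exchange_big.
  rewrite [RHS]exchange_big raddf_sum mulr_sumr; apply: eq_bigr => q _.
  rewrite raddf_sum mulr_sumr; apply: eq_bigr => i _.
  by rewrite /= (@sd_commM _ _ M) // mulr_sumr.
rewrite exchange_big [RHS]exchange_big; apply: eq_bigr => c _ /=.
rewrite [RHS]exchange_big; apply: eq_bigr => i _ /=.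
pose T b q := ycoefs f j *
  (sw j c (ycoefs g i) * sw c b (sw i q (ycoefs h (n - (b + q))))).
transitivity (\sum_(m < n.+1) \sum_(b < m.+1) T b (m - b)%N); last first.
  apply: eq_bigr => m _; rewrite /G sd_commD mulr_sumr.
  by apply: eq_bigr => b _; rewrite /T mulrA subnKC // -ltnS.
rewrite (@sum_triangle _ n.+1 n.+1 T) //; apply: eq_bigr => b _.
have lebn : (b <= n)%N by rewrite -ltnS.
rewrite (big_ord_widen n.+1 (fun q => ycoefs f j *
  (sw j c (ycoefs g i) * sw c b (sw i q (ycoefs h (n - b - q))))))
  ?ltnS ?leq_subr //.
by apply: eq_big => [q|q _]; rewrite /T ?subnDA // !ltnS leq_subRL.
Qed.

Definition ys_const (r : fps F) : R := Y (fun n => if n is 0 then r else 0).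
Definition ys_y : R := Y (fun n => (n == 1%N)%:R).

Lemma ys_const_mul r f n :
  ycoefs (ys_mul (ys_const r) f) n = r * ycoefs f n.
Proof.
apply: fps_ext => l; rewrite (@ys_mul_trunc (n + l).+1) //.
congr (coefs _ l); rewrite exchange_big /= big_ord_recl [X in _ + X]big1 ?addr0 => [|i _]; last first.
  by apply: big1 => k _; apply: mul0r.
rewrite big_ord_recl subn0 [X in _ + X]big1 ?addr0 // => k _.
exact: mulr0.
Qed.

Fact ys_mul1r : left_id ys_one ys_mul.
Proof.
have -> : ys_one = ys_const 1 by apply: ys_ext => -[].
by move=> f; apply: ys_ext => n; rewrite ys_const_mul mul1r.
Qed.

Fact ys_mulr1 : right_id ys_one ys_mul.
Proof.
move=> f; apply: ys_ext => n; apply: fps_ext => l.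
rewrite (@ys_mul_trunc (n + l).+1) //; congr (coefs _ l).
rewrite big_ord_recr /= [X in X + _]big1 ?add0r => [|k _]; last first.
  by rewrite big1 // => i _; rewrite subn_eq0 leqNgt ltn_ord raddf0 mulr0.
have ltn : (n < (n + l).+1)%N by rewrite ltnS leq_addr.
rewrite (bigD1 (Ordinal ltn)) //= subnn sd_comm1 eqxx mulr1.
rewrite big1 ?addr0 // => i; rewrite -val_eqE /= => /negPf nin.
by rewrite sd_comm1 nin mulr0.
Qed.

Fact ys_mulDl : left_distributive ys_mul +%R.
Proof.
move=> f g h; apply: ys_ext => n; apply: fps_ext => l.
rewrite ycoefsD coefsD !(@ys_mul_trunc (n + l).+1) // -coefsD -big_split /=.
congr (coefs _ l); apply: eq_bigr => k _; rewrite -big_split /=.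
by apply: eq_bigr => i _; rewrite mulrDl.
Qed.

Fact ys_mulDr : right_distributive ys_mul +%R.
Proof.
move=> f g h; apply: ys_ext => n; apply: fps_ext => l.
rewrite ycoefsD coefsD !(@ys_mul_trunc (n + l).+1) // -coefsD -big_split /=.
congr (coefs _ l); apply: eq_bigr => k _; rewrite -big_split /=.
by apply: eq_bigr => i _; rewrite raddfD mulrDr.
Qed.

Fact ys_one_neq0 : ys_one != 0.
Proof.
apply/eqP => /(congr1 (fun f => ycoefs f 0%N)) /= /eqP.
by rewrite oner_eq0.
Qed.

HB.instance Definition _ := GRing.Zmodule_isNzRing.Build R
  ys_mulA ys_mul1r ys_mulr1 ys_mulDl ys_mulDr ys_one_neq0.

Lemma ycoefs_constM r f n : ycoefs (ys_const r * f) n = r * ycoefs f n.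
Proof. exact: ys_const_mul. Qed.

Lemma ycoefs_Mconst r f N n l : (n + l < N)%N ->
  coefs (ycoefs (f * ys_const r) n) l =
  coefs (\sum_(i < N) ycoefs f i * sw i n r) l.
Proof.
move=> ltN; rewrite (@ys_mul_trunc N) //; congr (coefs _ l).
rewrite big_ord_recr /= [X in X + _]big1 ?add0r => [|k _]; last first.
  rewrite big1 // => i _; have := ltn_ord k; rewrite -subn_gt0.
  by case: (n - k)%N => // m _; rewrite raddf0 mulr0.
by rewrite subnn.
Qed.

Lemma ys_yM r : ys_y * ys_const r =
  ys_const (sd_sigma D r) * ys_y + ys_const (sd_delta D r).
Proof.
apply: ys_ext => n; apply: fps_ext => l.
rewrite (@ycoefs_Mconst _ _ (n + l).+2) // ycoefsD ycoefs_constM.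
congr (coefs _ l); rewrite big_ord_recl /= mul0r add0r.
rewrite big_ord_recl /= mul1r big1 ?addr0 => [|i _]; last by rewrite mul0r.
by case: n => [|[|n]]; rewrite /= ?mulr0 ?mulr1 ?add0r ?rmorph0 ?raddf0 ?addr0.
Qed.

End SkewPowerSeriesRing.

Definition const_linear (F : comNzRingType) (D : skewDerivation (fps F)) :=
  forall a : F, sd_sigma D (fps_const a) = fps_const a /\
                sd_delta D (fps_const a) = 0.

(* Main.v *)
(* The element [X] (the constant series x) is normal and regular in [R],
   [R / X R] is the commutative discrete valuation ring [F[[y]]], and [R] is
   complete for the [X]-adic filtration.  By successive approximation, an
   [X]-saturated ideal is generated, on either side, by any of its elements of
   least [y]-order modulo [X].  Let [J] be properly contained in [I].
   If [I / J] has elements killed by [X], then among them one lying as deep as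
   possible in the [X]-adic filtration is normal, because commutators in [R]
   lie in [X R] and would go one step deeper; saturations being generated by
   one element bounds the depth.  Otherwise take [X ^+ m * h] in [I], with [h]
   a generator of the [X]-saturation of [I]. *)
Require Import Defs.
From mathcomp Require Import all_boot all_order all_algebra.
From mathcomp Require Import boolp classical_sets.

Set Implicit Arguments.
Unset Strict Implicit.
Unset Printing Implicit Defensive.

Import GRing.Theory.

Local Open Scope classical_set_scope.
Local Open Scope ring_scope.

(** * Successive approximation in complete filtered groups *)

(** The errors [r n] sink through the separated filtration of [V] while the corrections sum to [s]
    by completeness of [U]. The predicate [P] keeps every error in a prescribed subset, such as an
    ideal. *)
Lemma lift_onto (U V : zmodType) (FU : nat -> U -> Prop) (FV : nat -> V -> Prop)
    (phi : {additive U -> V}) (P : V -> Prop) :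
  (forall c : nat -> U, (forall n, FU n (c n)) ->
     exists s, forall n, FU n (s - \sum_(i < n) c i)) ->
  (forall n, FU n 0) ->
  (forall n a b, FV n a -> FV n b -> FV n (a - b)) ->
  (forall a, (forall n, FV n a) -> a = 0) ->
  (forall n u, FU n u -> FV n (phi u)) ->
  (forall n a, P a -> FV n a ->
     exists c, [/\ FU n c, P (a - phi c) & FV n.+1 (a - phi c)]) ->
  forall a, P a -> FV 0 a -> exists s, a = phi s.
Proof.
move=> complU FU0 FVB sepV phiF step a Pa F0a.
(* Outside the range of [step] the correction is 0, which makes it a total function of depth and
   error. *)
have /choice[st stP] (z : nat * V) : exists c, P z.2 -> FV z.1 z.2 ->
    [/\ FU z.1 c, P (z.2 - phi c) & FV z.1.+1 (z.2 - phi c)].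
  have [[Pz Fz]|nPF] := pselect (P z.2 /\ FV z.1 z.2).
    by have [c cP] := step _ _ Pz Fz; exists c.
  by exists 0 => Pz Fz; case: nPF.
pose fix r n := if n is m.+1 then r m - phi (st (m, r m)) else a.
have rP n : P (r n) /\ FV n (r n).
  by elim: n => [|n [Pn Fn]] //=; have [] := stP (n, r n) Pn Fn.
pose c n := st (n, r n).
have cF n : FU n (c n) by have [Pn Fn] := rP n; have [] := stP (n, r n) Pn Fn.
have rE n : r n = a - phi (\sum_(i < n) c i).
  elim: n => [|n IHn]; first by rewrite big_ord0 raddf0 subr0.
  by rewrite big_ord_recr raddfD opprD addrA -IHn.
have [s sP] := complU c cF; exists s.
apply/eqP; rewrite -subr_eq0; apply/eqP/sepV => n.
have -> : a - phi s = r n - phi (s - \sum_(i < n) c i).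
  by rewrite rE raddfB opprB addrA subrK.
by apply: FVB; [case: (rP n) | apply: phiF].
Qed.

(** * Completeness and division in F[[x]] *)

Section FpsField.
Variable F : fieldType.
Implicit Types f g : fps F.

Lemma fps_vanishB i f g :
  fps_vanish i f -> fps_vanish i g -> fps_vanish i (f - g).
Proof. by move=> fi gi j ltj; rewrite coefsB fi ?gi ?subr0. Qed.

Lemma fps_vanish_eq0 f : (forall i, fps_vanish i f) -> f = 0.
Proof. by move=> f0; apply: fps_ext => i; apply: (f0 i.+1). Qed.

Lemma fps_complete (c : nat -> fps F) : (forall n, fps_vanish n (c n)) ->
  exists s, forall n, fps_vanish n (s - \sum_(i < n) c i).
Proof.
move=> cn; exists (Fps (fun l => \sum_(i < l.+1) coefs (c i) l)) => n l ltln.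
rewrite coefsB coefs_sum /= (big_ord_widen n (fun i => coefs (c i) l)) //.
rewrite [X in _ - X](bigID (fun i : 'I_n => (i < l.+1)%N)) /=.
rewrite [X in _ - (_ + X)]big1 ?addr0 ?subrr // => i; rewrite -leqNgt => lti.
exact: cn.
Qed.

Lemma coefs_vanishM d n f g : fps_vanish d f -> fps_vanish n g ->
  coefs (g * f) (n + d) = coefs g n * coefs f d.
Proof.
move=> fd gn; have ltn : (n < (n + d).+1)%N by rewrite ltnS leq_addr.
rewrite coefsM (bigD1 (Ordinal ltn)) //= addKn big1 ?addr0 // => i nin.
have [ltin|] := ltnP i n; first by rewrite gn ?mul0r.
rewrite leq_eqVlt => /orP[/eqP eni|ltni].
  by case/negP: nin; apply/eqP/val_inj.
by rewrite fd ?mulr0 // ltn_subLR ?ltn_add2r // -ltnS.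
Qed.

(** Since [g] has order exactly [d], the quotient is found one coefficient at a time, with the
    filtration of the target shifted by [d]. *)
Lemma fps_div d f g : fps_vanish d g -> coefs g d != 0 -> fps_vanish d f ->
  exists c, f = c * g.
Proof.
move=> gd gd0 fd.
pose phi : {additive fps F -> fps F} := g \o* idfun.
apply: (@lift_onto _ _ (@fps_vanish F) (fun n => fps_vanish (n + d)) phi
  (fun=> True)) => //.
- exact: fps_complete.
- by move=> n a b; apply: fps_vanishB.
- move=> a a0; apply: fps_ext => i; apply: (a0 i.+1).
  by rewrite addSn ltnS leq_addr.
- by move=> n u un; apply: fps_vanishM.
move=> n a _ an.
(* The monomial that cancels the coefficient of [a] of index [n + d]. *)
pose c : fps F :=
  Fps (fun i => if i == n then coefs a (n + d) / coefs g d else 0).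
have cn : fps_vanish n c by move=> i; rewrite /= ltn_neqAle => /andP[/negPf->].
exists c; split=> //; rewrite (_ : phi c = c * g) // => i.
rewrite addSn ltnS leq_eqVlt => /orP[/eqP->|lti].
  by rewrite coefsB coefs_vanishM //= eqxx divfK ?subrr.
by rewrite coefsB an // (fps_vanishM cn gd) ?subr0.
Qed.

End FpsField.

(** * The X-adic filtration and the normality of X *)

Section SkewSeries.
Variables (F : fieldType) (D : skewDerivation (fps F)).
Variable locD : local_skew (@fps_max F) D.
Local Notation R := (skewPowerSeries locD).
Local Notation sw := (sd_comm D).
Local Notation X := (ys_const locD (fps_x F)).
Implicit Types (f g a b : R) (I J : twoSidedIdeal R).

(** The right ideal generated by [X ^+ n] ([xdivXP]), read on coefficients: this form favours no
    side and reduces completeness to that of [fps F]. *)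
Definition xdiv n f := forall j, fps_vanish n (ycoefs f j).

Lemma ycoefsN f j : ycoefs (- f) j = - ycoefs f j. Proof. by []. Qed.

Lemma ycoefs_sum (I : Type) (r : seq I) (f : I -> R) j :
  ycoefs (\sum_(k <- r) f k) j = \sum_(k <- r) ycoefs (f k) j.
Proof. by elim/big_rec2: _ => // k a b _ <-; rewrite ycoefsD. Qed.

Lemma xdivB n f g : xdiv n f -> xdiv n g -> xdiv n (f - g).
Proof. by move=> fn gn j; rewrite ycoefsD ycoefsN; apply: fps_vanishB. Qed.

Lemma xdiv_eq0 f : (forall n, xdiv n f) -> f = 0.
Proof.
by move=> f0; apply: ys_ext => j; apply: fps_vanish_eq0 => i; apply: f0.
Qed.

Lemma xdiv_complete (c : nat -> R) : (forall n, xdiv n (c n)) ->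
  exists s, forall n, xdiv n (s - \sum_(i < n) c i).
Proof.
move=> cn.
have /choice[s sP] j : exists s : fps F,
    forall n, fps_vanish n (s - \sum_(i < n) ycoefs (c i) j).
  by apply: (@fps_complete F (fun i => ycoefs (c i) j)) => n; apply: cn.
exists (SkewPowerSeries locD s) => n j.
by rewrite ycoefsD ycoefsN ycoefs_sum; apply: sP.
Qed.

(** [sw e k] never lowers the x-adic order: it raises it by at least [e - k], and is zero for
    [e < k]. *)
Lemma xdivM i j f g : xdiv i f -> xdiv j g -> xdiv (i + j) (f * g).
Proof.
move=> fi gj n l ltl; rewrite (@ys_mul_trunc _ _ _ (n + l).+1) // coefs_sum.
apply: big1 => k _; rewrite coefs_sum; apply: big1 => e _.
have [ltek|leke] := ltnP e k; first by rewrite sd_comm_gt // mulr0.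
apply: fps_vanishM ltl; first exact: fi.
apply: fps_vanish_le (vanish_sw locD (gj _)).
by rewrite -addnBA ?leq_addr.
Qed.

Lemma xdivXP n f : xdiv n f <-> exists g, f = X ^+ n * g.
Proof.
elim: n f => [|n IHn] f; first by split=> // _; exists f; rewrite mul1r.
split=> [fn|[g ->] j].
  pose h : R := SkewPowerSeries locD
    (fun j => Fps (fun i => coefs (ycoefs f j) i.+1)).
  have [|g hg] := (IHn h).1; first by move=> j i lti; apply: fn.
  exists g; rewrite exprS -mulrA -hg; apply: ys_ext => j; rewrite ycoefs_constM.
  by apply: fps_ext => -[|i]; rewrite coefs_xM //; apply: fn.
rewrite exprS -mulrA ycoefs_constM => -[|i] lti; rewrite coefs_xM //.
by have := (IHn (X ^+ n * g)).2 (ex_intro _ g erefl); apply.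
Qed.

Lemma xdivX n f : xdiv n (X ^+ n * f). Proof. by apply/xdivXP; exists f. Qed.

Lemma xdivX1 f : xdiv 1 (X * f). Proof. exact: (@xdivX 1). Qed.

Lemma xdivXn n : xdiv n (X ^+ n).
Proof. by rewrite -[X ^+ n]mulr1; apply: xdivX. Qed.

(** Here [sw n n] is sigma iterated n times; being bijective and mapping each power of the maximal
    ideal onto itself, sigma preserves orders exactly. *)
Lemma coefs_sigmaX n : coefs (sw n n (fps_x F)) 1 != 0.
Proof.
suff sig u i : fps_vanish i (sd_sigma D u) -> fps_vanish i u.
  have: ~ fps_vanish 2 (fps_x F) by move/(_ 1%N isT)/eqP; rewrite oner_eq0.
  have vn m : fps_vanish 1 (sw m m (fps_x F)).
    by apply: fps_vanish_le (@vanish_sw _ _ locD 1 m m _ _) => [|[]//];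
      rewrite addnK.
  have -> : fps_vanish 2 (fps_x F) <-> fps_vanish 2 (sw n n (fps_x F)).
    elim: n => [|n IHn] //=.
    rewrite (@sd_comm_gt _ _ n n.+1) // raddf0 addr0 IHn.
    by split=> [/(vanish_sigma locD)|/sig].
  by apply: contra_notN => /eqP w0 [|[]] // _; apply: vn.
move/fps_ideal_expE; have [<- _] := locD i => -[v /fps_ideal_expE vi].
by move/(bij_inj (sd_sigma_bij D)) <-.
Qed.

(** Modulo x^2 only the term [i = n] survives: smaller [i] give zero, and larger ones involve a
    delta, which raises the order of x to at least 2. *)
Lemma coefs_mulrX f n : coefs (ycoefs (f * X) n) 1 =
  coefs (ycoefs f n) 0 * coefs (sw n n (fps_x F)) 1.
Proof.
have vx : fps_vanish 1 (fps_x F) by case.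
have vsw i : fps_vanish (1 + i - n) (sw i n (fps_x F)) by apply: vanish_sw.
rewrite (@ycoefs_Mconst _ _ _ _ _ (n + 2)) ?ltn_add2l //.
have ltn : (n < n + 2)%N by rewrite addn2.
rewrite (bigD1 (Ordinal ltn)) // coefsD.
rewrite [X in _ + X](_ : _ = 0) ?addr0.
  apply: (@coefs_vanishM _ 1 0) => //.
  by apply: fps_vanish_le (vsw n); rewrite addnK.
rewrite coefs_sum big1 // => i; rewrite -val_eqE neq_ltn => /orP[] ltin.
  by rewrite sd_comm_gt // mulr0.
have : fps_vanish (0 + 2) (ycoefs f i * sw i n (fps_x F)).
  apply: fps_vanishM => //; apply: fps_vanish_le (vsw i).
  by rewrite -addnBA ?(ltnW ltin) // add1n ltnS subn_gt0.
exact.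
Qed.

(** Moving [X] across scales each coefficient modulo x by a nonzero constant ([coefs_sigmaX]), hence
    preserves y-orders. *)
Lemma coefs_swap f g n : f * X = X * g ->
  coefs (ycoefs g n) 0 = coefs (ycoefs f n) 0 * coefs (sw n n (fps_x F)) 1.
Proof. by rewrite -coefs_mulrX => ->; rewrite ycoefs_constM coefs_xM. Qed.

Lemma swapXl n f : exists g, f * X ^+ n = X ^+ n * g.
Proof.
apply/xdivXP; rewrite -[n in xdiv n]add0n; apply: xdivM => //.
exact: xdivXn.
Qed.

Lemma swapX_onto g : exists f, f * X = X * g.
Proof.
pose phi : {additive R -> R} := X \o* idfun.
suff [f ->] : exists f, X * g = phi f by exists f.
apply: (@lift_onto _ _ xdiv (fun n => xdiv n.+1) phi (fun=> True)) => //.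
- exact: xdiv_complete.
- by move=> n a b; apply: xdivB.
- by move=> a a0; apply: xdiv_eq0 => -[|n].
- move=> n u un; rewrite -addn1; apply: xdivM => //.
  by rewrite -[X]mulr1; apply: xdivX1.
- move=> n a _ /xdivXP[b ->].
  (* Chosen so that [c * X] and [X * b] agree modulo [X ^+ 2]. *)
  pose c : R := SkewPowerSeries locD (fun j =>
    fps_const (coefs (ycoefs b j) 0 / coefs (sw j j (fps_x F)) 1)).
  exists (X ^+ n * c); split=> //; first exact: xdivX.
  rewrite /= exprSr -!mulrA -mulrBr -addn2; apply: xdivM.
    exact: xdivXn.
  move=> j [|[]] // _; rewrite ycoefsD ycoefsN coefsB.
    rewrite ycoefs_constM coefs_xM.
    have [e ->] := swapXl 1 c.
    by rewrite ycoefs_constM coefs_xM subr0.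
  rewrite ycoefs_constM coefs_xM coefs_mulrX /= divfK ?subrr //.
  exact: coefs_sigmaX.
- exact: xdivX1.
Qed.

Lemma swapXr n g : exists f, f * X ^+ n = X ^+ n * g.
Proof.
elim: n g => [|n IHn] g; first by exists g; rewrite mulr1 mul1r.
have [h hg] := IHn g; have [f fh] := swapX_onto h.
by exists f; rewrite exprS mulrA fh -mulrA hg mulrA.
Qed.

(** * Reduction modulo X to F[[y]] *)

Hypothesis linD : const_linear D.

(** The image of [f] in [R / X R]; the variable of this series is y. *)
Definition red f : fps F := Fps (fun n => coefs (ycoefs f n) 0).

Lemma redP f : red f = 0 <-> xdiv 1 f.
Proof.
split=> [f0 j [] // _|f0]; last by apply: fps_ext => j; apply: f0.
exact: (congr1 (fun h => coefs h j) f0).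
Qed.

Lemma redB f g : red (f - g) = red f - red g.
Proof. exact: fps_ext. Qed.

(** Linearity fixes constants and locality preserves the maximal ideal, so sigma is trivial on the
    residue field. *)
Lemma coefs_sigma0 u : coefs (sd_sigma D u) 0 = coefs u 0.
Proof.
have [v v1 ->] : exists2 v, fps_vanish 1 v & u = fps_const (coefs u 0) + v.
  exists (u - fps_const (coefs u 0)); last by rewrite addrC subrK.
  by move=> [] // _; rewrite coefsB subrr.
by rewrite rmorphD (linD _).1 !coefsD (vanish_sigma locD v1) // (v1 0%N).
Qed.

Lemma coefs_sw0 n u : coefs (sw n n u) 0 = coefs u 0.
Proof.
elim: n => [|n IHn] //=.
by rewrite (@sd_comm_gt _ _ n n.+1) // raddf0 addr0 coefs_sigma0.
Qed.

(** Words containing a delta vanish modulo x, and those in sigma alone fix constant terms, so the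
    product becomes the commutative one. *)
Lemma redM f g : red (f * g) = red f * red g.
Proof.
apply: fps_ext => n; rewrite coefsM.
rewrite [LHS](@ys_mul_trunc _ D locD n.+1 f g n 0) ?addn0 //.
rewrite coefs_sum; apply: eq_bigr => k _.
rewrite (bigD1 k) // coefsD [X in _ + X](_ : _ = 0) ?addr0.
  by rewrite coefsM big_ord1 coefs_sw0.
rewrite coefs_sum big1 // => i; rewrite -val_eqE neq_ltn => /orP[] ltik.
  by rewrite sd_comm_gt // mulr0.
have vsw : fps_vanish (0 + i - k) (sw i k (ycoefs g (n - k))).
  exact: vanish_sw.
by rewrite coefsM big_ord1 vsw ?mulr0 // subn_gt0.
Qed.

Lemma xdiv_comm f g : xdiv 1 (f * g - g * f).
Proof. by apply/redP; rewrite redB !redM mulrC subrr. Qed.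

Definition yorder d f := fps_vanish d (red f) /\ coefs (red f) d != 0.

Lemma yorder_ex f : ~ xdiv 1 f -> exists d, yorder d f.
Proof.
move=> nf; have ex : exists n, coefs (red f) n != 0.
  apply: contra_notP nf => nex; apply/redP/fps_ext => n.
  by apply/eqP; apply: contra_notT nex => fn; exists n.
case: (ex_minnP ex) => d fd dmin; exists d; split=> // i ltid.
by apply/eqP; apply: contraTT ltid => /dmin; rewrite -leqNgt.
Qed.

(** * Saturated ideals have a single generator on either side *)

Definition saturated J := forall a, ideal_set J (X * a) -> ideal_set J a.

Lemma saturatedX J n a :
  saturated J -> ideal_set J (X ^+ n * a) -> ideal_set J a.
Proof.
move=> satJ; elim: n => [|n IHn]; first by rewrite mul1r.
by rewrite exprS -mulrA => /satJ.
Qed.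

Lemma saturated_genl J g d : saturated J -> ideal_set J g -> yorder d g ->
  (forall a, ideal_set J a -> fps_vanish d (red a)) ->
  forall a, ideal_set J a -> exists c, a = c * g.
Proof.
move=> satJ Jg [gd gd0] dmin a Ja.
pose phi : {additive R -> R} := g \o* idfun.
suff [c ->] : exists c, a = phi c by exists c.
apply: (@lift_onto _ _ xdiv xdiv phi (ideal_set J)) => // {a Ja}.
- exact: xdiv_complete.
- exact: xdivB.
- exact: xdiv_eq0.
- by move=> n u un; rewrite -[n]addn0; apply: xdivM.
move=> n a Ja /xdivXP[b ab].
(* Saturation strips [X ^+ n] off the error, after which [red g] divides [red b] because its order
   is minimal. *)
have Jb : ideal_set J b by apply: (@saturatedX _ n) => //; rewrite -ab.
have [e be] := fps_div gd gd0 (dmin b Jb).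
(* The lift of [e] with constant coefficients. *)
pose c : R := SkewPowerSeries locD (fun j => fps_const (coefs e j)).
exists (X ^+ n * c); split; first exact: xdivX.
  by apply: idealB => //; apply: idealMl.
rewrite /= ab -mulrA -mulrBr -addn1; apply: xdivM.
  exact: xdivXn.
apply/redP; rewrite redB redM be (_ : red c = e) ?subrr //.
exact: fps_ext.
Qed.

Lemma saturated_genr J g d : saturated J ->
  (forall a, ideal_set J (a * X) -> ideal_set J a) ->
  ideal_set J g -> yorder d g ->
  (forall a, ideal_set J a -> fps_vanish d (red a)) ->
  forall a, ideal_set J a -> exists c, a = g * c.
Proof.
move=> satJ satrJ Jg gd dmin a Ja.
have satrJn n b : ideal_set J (b * X ^+ n) -> ideal_set J b.
  by elim: n => [|n IHn]; rewrite ?mulr1 // exprSr mulrA => /satrJ.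
pose phi : {additive R -> R} := g \*o idfun.
suff [c ->] : exists c, a = phi c by exists c.
apply: (@lift_onto _ _ xdiv xdiv phi (ideal_set J)) => // {a Ja}.
- exact: xdiv_complete.
- exact: xdivB.
- exact: xdiv_eq0.
- by move=> n u un; rewrite -[n]add0n; apply: xdivM.
move=> n a Ja /xdivXP[b' ab'].
(* With the power of [X] on the right, [b] lies in [J] by right saturation, so [b = c * g].
   Exchanging [c] and [g] costs a commutator, and the error gains a factor [X]. *)
have [b bb'] := swapXr n b'; rewrite -{}bb' in ab'.
have Jb : ideal_set J b by apply: (satrJn n); rewrite -ab'.
have [c bc] := saturated_genl satJ Jg gd dmin Jb.
have Xn : xdiv n (X ^+ n) := @xdivXn n.
exists (c * X ^+ n); split; first by rewrite -[n in xdiv n]add0n; apply: xdivM.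
  by apply: idealB => //; apply: Defs.idealMr.
by rewrite /= ab' mulrA -mulrBl bc -add1n; apply: xdivM => //; apply: xdiv_comm.
Qed.

Lemma saturated_gen J : saturated J -> exists g,
  [/\ ideal_set J g, forall a, ideal_set J a -> exists c, a = c * g
         & forall a, ideal_set J a -> exists c, a = g * c].
Proof.
move=> satJ.
have [nz|z] := pselect (exists d g, ideal_set J g /\ yorder d g); last first.
  (* Every element of [J] is divisible by [X] with quotient again in [J], hence is infinitely
     divisible. *)
  have J0 a : ideal_set J a -> a = 0.
    move=> Ja; apply: xdiv_eq0 => n; elim: n a Ja => [|n IHn] a Ja //.
    have /xdivXP[b ab] : xdiv 1 a.
      by apply: contra_notP z => /yorder_ex[d ad]; exists d, a.
    rewrite ab -add1n; apply: xdivM; last by apply/IHn/satJ; rewrite -ab.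
    by rewrite -[X]mulr1; apply: xdivX1.
  exists 0; split; first exact: ideal0.
    by move=> a /J0->; exists 0; rewrite mulr0.
  by move=> a /J0->; exists 0; rewrite mulr0.
have exb : exists d, `[< exists g, ideal_set J g /\ yorder d g >].
  by have [d dP] := nz; exists d; apply/asboolP.
case: (ex_minnP exb) => d /asboolP[g [Jg gd]] dmin.
have van a : ideal_set J a -> fps_vanish d (red a).
  move=> Ja; have [/redP-> //|/yorder_ex[e ae]] := pselect (xdiv 1 a).
  apply: fps_vanish_le ae.1; apply: dmin; apply/asboolP; by exists a.
have genl := saturated_genl satJ Jg gd van.
have colonP a b : a * X = X * b -> ideal_set J (a * X) <-> ideal_set J b.
  by move=> ->; split=> [/satJ|/(idealMl X)].
(* The right colon ideal of J by X is again saturated and its elements have the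
   same y-orders as those of J, so g generates both. *)
have sub0 : ideal_set J (0 * X) by rewrite mul0r; apply: ideal0.
have subB u v : ideal_set J (u * X) -> ideal_set J (v * X) ->
    ideal_set J ((u - v) * X).
  by move=> Ju Jv; rewrite mulrBl; apply: idealB.
have subMl u v : ideal_set J (v * X) -> ideal_set J (u * v * X).
  by move=> Jv; rewrite -mulrA; apply: idealMl.
have subMr u v : ideal_set J (v * X) -> ideal_set J (v * u * X).
  move=> Jv; rewrite -mulrA; have [w] := swapXl 1 u; rewrite !expr1 => ->.
  by rewrite mulrA; apply: Defs.idealMr.
pose J' := @TwoSidedIdeal R [set a | ideal_set J (a * X)] sub0 subB subMl subMr.
have satJ' : saturated J' by move=> a; rewrite /= -mulrA => /satJ.
have genl' : forall a, ideal_set J' a -> exists c, a = c * g.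
  apply: (saturated_genl satJ' _ gd); first exact: Defs.idealMr.
  move=> a Ja i ltid; have [b] := swapXl 1 a; rewrite !expr1 => ab.
  have /van/(_ i ltid)/eqP : ideal_set J b by apply/(colonP _ _ ab).
  rewrite /= (coefs_swap i ab) mulf_eq0 (negPf (coefs_sigmaX i)) orbF.
  by move/eqP.
(* By [genl'] the colon ideal lies in the left ideal of [g], hence in [J]; this is the right
   saturation that [saturated_genr] asks for. *)
exists g; split=> //; apply: saturated_genr gd van => // a Ja.
by have [c ->] := genl' a Ja; apply: idealMl.
Qed.

(** * The X-saturation of an ideal *)

Section Saturation.
Variable J : twoSidedIdeal R.

Let sat : set R := [set a | exists n, ideal_set J (X ^+ n * a)].

Fact sat0 : sat 0.
Proof. by exists 0%N; rewrite mulr0; apply: ideal0. Qed.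

Fact satB u v : sat u -> sat v -> sat (u - v).
Proof.
move=> [m Ju] [n Jv]; exists (m + n)%N; rewrite mulrBr; apply: idealB.
  by rewrite addnC exprD -mulrA; apply: idealMl.
by rewrite exprD -mulrA; apply: idealMl.
Qed.

Fact satMl a u : sat u -> sat (a * u).
Proof.
move=> [n Ju]; exists n; have [b] := swapXr n a.
by rewrite mulrA => <-; rewrite -mulrA; apply: idealMl.
Qed.

Fact satMr a u : sat u -> sat (u * a).
Proof. by move=> [n Ju]; exists n; rewrite mulrA; apply: Defs.idealMr. Qed.

Definition saturation := TwoSidedIdeal sat0 satB satMl satMr.

Lemma saturation_saturated : saturated saturation.
Proof. by move=> a [n Ja]; exists n.+1; rewrite exprSr -mulrA. Qed.

Lemma saturation_gen : exists h m, ideal_set J (X ^+ m * h) /\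
  forall a, ideal_set saturation a ->
    (exists c, a = c * h) /\ (exists c, a = h * c).
Proof.
have [h [[m Jh] hl hr]] := saturated_gen saturation_saturated.
by exists h, m; split=> // a Ja; split; [apply: hl | apply: hr].
Qed.

(** The [X]-power torsion of [R / J] has bounded exponent: the power of [X] that brings the
    generator [h] into [J] serves all its left multiples, as [X] is normal. *)
Lemma saturation_exp : exists m, forall a n,
  ideal_set J (X ^+ n * a) -> ideal_set J (X ^+ m * a).
Proof.
have [h [m [Jh hP]]] := saturation_gen; exists m => a n Ja.
have [|[c ->] _] := hP a; first by exists n.
by have [b] := swapXr m c; rewrite mulrA => <-; rewrite -mulrA; apply: idealMl.
Qed.

End Saturation.

(** * Normal elements in quotients of ideals *)

Lemma normal_quot J a :
  (forall s, exists t, ideal_set J (a * s - t * a)) ->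
  (forall s, exists t, ideal_set J (s * a - a * t)) ->
  normal_element (quot_proj J a).
Proof.
move=> al ar; apply/seteqP; split=> _ [s _ <-]; rewrite -(quot_projK s).
  have [t Jt] := al (repr s); exists (quot_proj J t) => //.
  by rewrite -!rmorphM; apply/esym/quot_projP.
have [t Jt] := ar (repr s); exists (quot_proj J t) => //.
by rewrite -!rmorphM; apply/esym/quot_projP.
Qed.

Lemma skew_polynormal : polynormal R.
Proof.
move=> I J [sJI nsIJ].
suff [a [Ia nJa al ar]] : exists a, [/\ ideal_set I a, ~ ideal_set J a,
    forall s, exists t, ideal_set J (a * s - t * a)
  & forall s, exists t, ideal_set J (s * a - a * t)].
  exists (quot_proj J a); split; [by exists a | | exact: normal_quot].
  apply/eqP => a0; apply: nJa; rewrite -[a]subr0; apply/quot_projP.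
  by rewrite a0 raddf0.
have [tors|tfree] := pselect (exists a,
    [/\ ideal_set I a, ~ ideal_set J a & ideal_set J (X * a)]).
  have [m mP] := saturation_exp J.
  pose P n := `[< exists a,
    [/\ ideal_set I a, ~ ideal_set J a, ideal_set J (X * a) & xdiv n a] >].
  have exP : exists n, P n.
    by have [a [? ? ?]] := tors; exists 0%N; apply/asboolP; exists a.
  (* For [n] beyond [m], [saturation_exp] would put [X ^+ m * b], hence [a], in [J]. *)
  have ubP n : P n -> (n <= m)%N.
    move=> /asboolP[a [_ nJa JXa /xdivXP[b ab]]]; rewrite leqNgt.
    apply/negP => ltmn; apply: nJa.
    rewrite ab -(subnK (ltnW ltmn)) exprD -mulrA; apply: idealMl.
    by apply: (mP _ n.+1); rewrite exprS -mulrA -ab.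
  case: (ex_maxnP exP ubP) => n /asboolP[a [Ia nJa JXa an]] nmax.
  have maxJ c : ideal_set I c -> ideal_set J (X * c) -> xdiv n.+1 c ->
      ideal_set J c.
    move=> Ic JXc cn; apply: contrapT => nJc.
    have : (n < n)%N by apply/nmax/asboolP; exists c.
    by rewrite ltnn.
  have Xcomm s t : ideal_set J (X * (a * s - t * a)).
    have [u] := swapXr 1 t; rewrite !expr1 => ut.
    rewrite mulrBr !mulrA -ut -(mulrA u); apply: idealB.
      exact: Defs.idealMr.
    exact: idealMl.
  have /xdivXP[b ab] := an.
  have Xn : xdiv n (X ^+ n) := @xdivXn n.
  (* The difference is [X ^+ n] times the commutator of [b] and [s], so it is deeper than the
     maximal depth [n] and falls into [J]. *)
  have key s t : t * X ^+ n = X ^+ n * s -> ideal_set J (a * s - t * a).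
    move=> ts; apply: maxJ => //.
      by apply: idealB; [apply: Defs.idealMr | apply: idealMl].
    rewrite {1 2}ab [t * _]mulrA ts -!mulrA -mulrBr -addn1.
    by apply: xdivM => //; apply: xdiv_comm.
  exists a; split=> // s.
    by have [t ts] := swapXr n s; exists t; apply: key.
  have [t ts] := swapXl n s; exists t; rewrite -opprB -sub0r.
  by apply: idealB; [apply: ideal0 | apply: key].
have tf n c : ideal_set I c -> ideal_set J (X ^+ n * c) -> ideal_set J c.
  elim: n c => [|n IHn] c Ic; first by rewrite mul1r.
  rewrite exprSr -mulrA => /IHn JXc; apply: contrapT => nJc.
  by apply: tfree; exists c; split=> //; apply: JXc; apply: idealMl.
have [h [m [Ih hP]]] := saturation_gen I.
have Sh : ideal_set (saturation I) h by exists m.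
exists (X ^+ m * h); split=> //.
(* Otherwise [X ^+ m * c] would lie in [J] for every [c] in [I], and [tf] would put [I] inside
   [J]. *)
- move=> Jh; apply: nsIJ => c Ic; have [|[e ce] _] := hP c.
    by exists 0%N; rewrite mul1r.
  apply: (tf m) => //; have [b be] := swapXr m e.
  by rewrite ce mulrA -be -mulrA; apply: idealMl.
(* Normality already holds in [R]: [h] generates the saturation from either side, and [X ^+ m] is
   normal. *)
- move=> s; have [[c hc] _] := hP _ (Defs.idealMr s Sh).
  have [t tc] := swapXr m c; exists t.
  by rewrite -mulrA hc !mulrA tc subrr; apply: ideal0.
move=> s; have [t st] := swapXl m s.
have [_ [c hc]] := hP _ (idealMl t Sh).
by exists c; rewrite mulrA st -!mulrA hc subrr; apply: ideal0.
Qed.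

End SkewSeries.

Theorem corollary5p18 (p : nat) (hp : prime p)
  (D : skewDerivation (fps 'F_p)) (locD : local_skew (@fps_max 'F_p) D)
  (linD : const_linear D) :
  polynormal (skewPowerSeries locD).
Proof. exact: skew_polynormal. Qed.
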